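(* For every $n\ge1$ there exists a bijection $\varphi:\mathfrak{S}_n(3124,3214)\to\mathfrak{S}_n(3142,3241)$ such that for every $\pi\in\mathfrak{S}_n(3124,3214)$, $$(\mathrm{Br},\mathrm{Ides},\mathrm{Lrmax},\mathrm{Lrmin},\mathrm{Iar})(\pi)=(\mathrm{Br},\mathrm{Ides},\mathrm{Lrmax},\mathrm{Lrmin},\mathrm{Iar})(\varphi(\pi)).$$
   Context: $\mathfrak{S}_n$ is the set of permutations of $[n]$ written as words $\pi_1\cdots\pi_n$; $\pi$ contains a pattern $P$ (a permutation of $[k]$) if some subsequence $\pi_{i_1}\cdots\pi_{i_k}$, $i_1<\dots<i_k$, is order-isomorphic to $P$, otherwise it avoids $P$; $\mathfrak{S}_n(P_1,\dots,P_r)$ is the set of permutations avoiding all $P_i$. Statistics: $\mathrm{Ides}(\pi)=\{i\in[n-1]:\pi^{-1}(i)>\pi^{-1}(i+1)\}$; $\mathrm{Lrmax}(\pi)$ (resp. $\mathrm{Lrmin}(\pi)$) is the set of letters $\pi_i$ greater (resp. smaller) than all letters to their left; $\mathrm{Iar}(\pi)=\{\pi_1,\dots,\pi_m\}$ with $m$ maximal such that $\pi_1<\dots<\pi_m$. With the convention $\pi_0=\pi_{n+1}=0$, the peak set is $\mathrm{Pk}(\pi)=\{\pi_i:1\le i\le n,\ \pi_{i-1}<\pi_i>\pi_{i+1}\}$, and $\mathrm{Br}(\pi)=\mathrm{Lrmax}(\pi)\cap\mathrm{Pk}(\pi)$. *)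

(* Defs.v *)
From mathcomp Require Import all_boot all_order all_fingroup.
Set Implicit Arguments. Unset Strict Implicit. Unset Printing Implicit Defensive.

(* Permutations of [n] are elements s of 'S_n (permutations of 'I_n = {0..n-1});
   the word pi_1 ... pi_n is given by pi_i = s(i-1) + 1, so letters are 1..n. *)
Definition word n (s : 'S_n) : seq nat := [seq (val (s i)).+1 | i <- enum 'I_n].

Definition order_iso (u v : seq nat) : bool :=
  (size u == size v) &&
  all (fun i => all (fun j =>
     (nth 0 u i < nth 0 u j) == (nth 0 v i < nth 0 v j)) (iota 0 (size u))) (iota 0 (size u)).

Definition contains (w P : seq nat) : Prop :=
  exists m : bitseq, size m = size w /\ order_iso (mask m w) P.

Definition avoids (w P : seq nat) : Prop := ~ contains w P.

(* Statistics; each is a set of letters/values, encoded as the increasing list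
   of elements of [1..n] satisfying the defining property. *)

Definition pos (w : seq nat) (a : nat) : nat := (index a w).+1.

Definition Ides (w : seq nat) : seq nat :=
  [seq i <- iota 1 (size w).-1 | pos w i > pos w i.+1].

(* 1-indexed access with convention pi_0 = pi_{n+1} = 0 *)
Definition letter (w : seq nat) (i : nat) : nat := if i is k.+1 then nth 0 w k else 0.

Definition Lrmax (w : seq nat) : seq nat :=
  [seq letter w i | i <- iota 1 (size w) &
     all (fun j => letter w j < letter w i) (iota 0 i)].
(* note: j ranges over 0..i-1, and letter w 0 = 0 < any letter; this is the same
   as j ranging over 1..i-1 *)

Definition Lrmin (w : seq nat) : seq nat :=
  [seq letter w i | i <- iota 1 (size w) &
     all (fun j => (j == 0) || (letter w i < letter w j)) (iota 0 i)].

(* Iar: {pi_1,...,pi_m} with m maximal such that pi_1 < ... < pi_m *)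
Definition Iar (w : seq nat) : seq nat :=
  [seq letter w i | i <- iota 1 (size w) &
     all (fun j => (j == 0) || (letter w j < letter w j.+1)) (iota 0 i)].

Definition Pk (w : seq nat) : seq nat :=
  [seq letter w i | i <- iota 1 (size w) &
     (letter w i.-1 < letter w i) && (letter w i.+1 < letter w i)].

Definition Br (w : seq nat) : seq nat := [seq a <- Lrmax w | a \in Pk w].

Definition same_set (u v : seq nat) : Prop := u =i v.

Definition stats_eq (w1 w2 : seq nat) : Prop :=
  [/\ same_set (Br w1) (Br w2), same_set (Ides w1) (Ides w2),
      same_set (Lrmax w1) (Lrmax w2), same_set (Lrmin w1) (Lrmin w2)
    & same_set (Iar w1) (Iar w2)].

Definition in_A n (s : 'S_n) : Prop := avoids (word s) [:: 3; 1; 2; 4] /\ avoids (word s) [:: 3; 2; 1; 4].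
Definition in_B n (s : 'S_n) : Prop := avoids (word s) [:: 3; 1; 4; 2] /\ avoids (word s) [:: 3; 2; 4; 1].

(* Main.v *)
Require Import Defs.
From mathcomp Require Import all_boot all_order all_fingroup.
From mathcomp Require Import zify.
Set Implicit Arguments. Unset Strict Implicit. Unset Printing Implicit Defensive.

(** Grow permutations by inserting a new maximum.  Call a site of a word active
    if inserting a new maximum there keeps it in its class.  In both classes,
    if [s_0 < ... < s_r] are the active sites, inserting at [s_i = j] yields a
    word whose active sites are [s_0, ..., s_i], [j + 1] and, when [i < r], one
    further site: [j + 2] for the class of 3124 and 3214, the end of the word
    for the class of 3142 and 3241.  Hence both classes are enumerated by the
    same codes, sequences of ranks of active sites, and the bijection matches
    words with equal codes.  It preserves the statistics because their change
    under an insertion depends only on a few properties of the chosen site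
    ([same_site]), and those evolve in the same way in both classes. *)

(** * Subsequences of a word with a distinguished letter *)

Lemma subseq_cat_del (T : eqType) (m : T) (s p q : seq T) :
  m \notin s -> subseq s (p ++ m :: q) = subseq s (p ++ q).
Proof.
elim: p s => [|x p IHp] s ms /=.
  by case: s ms => [|y s]; rewrite ?sub0seq // inE eq_sym; case: eqP.
case: s ms => // y s; rewrite inE negb_or => /andP[my ms].
by case: eqP => _; apply: IHp => //; rewrite inE negb_or my.
Qed.

(** The letter [m] occurs only once in [p ++ m :: q], so an embedding must send the displayed [m] to
    that occurrence and splits there. *)
Lemma subseq_cat_mid (T : eqType) (m : T) (s1 s2 p q : seq T) :
  m \notin p -> m \notin q -> m \notin s1 ->
  subseq (s1 ++ m :: s2) (p ++ m :: q) = subseq s1 p && subseq s2 q.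
Proof.
move=> mp mq; elim: p s1 mp => [|x p IHp] s1 mp ms.
  case: s1 ms => [|y s1]; first by rewrite /= eqxx.
  rewrite inE negb_or eq_sym => /andP[/negPf ym _] /=; rewrite ym.
  apply/negP => /mem_subseq /(_ m); rewrite (negPf mq) inE mem_cat mem_head !orbT.
  by move/(_ isT).
move: mp; rewrite inE negb_or => /andP[/negPf mx mp].
case: s1 ms => [|y s1] /=; first by rewrite mx => _; rewrite (IHp [::]) // sub0seq.
rewrite inE negb_or => /andP[my ms]; case: eqP => _; first exact: IHp.
by rewrite -(IHp (y :: s1)) // inE negb_or my.
Qed.

(** * Insertion of a new maximum and active sites *)

Definition ins (j m : nat) (w : seq nat) := take j w ++ m :: drop j w.

(* [sel = true] stands for the class avoiding 3124 and 3214, [sel = false] for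
   the class avoiding 3142 and 3241. *)
Definition pattern (sel : bool) (a b c d : nat) :=
  if sel then [:: a; b; c; d] else [:: a; b; d; c].

Definition avoider (sel : bool) (w : seq nat) :=
  forall a b c d, b < a -> c < a -> a < d -> ~~ subseq (pattern sel a b c d) w.

(** This forbids the three letters that a maximum inserted at [j], playing [d], would complete to an
    occurrence. *)
Definition active (sel : bool) (w : seq nat) (j : nat) :=
  forall a b c, b < a -> c < a ->
    ~~ (if sel then subseq [:: a; b; c] (take j w)
        else subseq [:: a; b] (take j w) && (c \in drop j w)).

Lemma notin_big (m : nat) (w : seq nat) : all (ltn^~ m) w -> m \notin w.
Proof. by move=> /allP wm; apply/negP => /wm /=; rewrite ltnn. Qed.

Lemma all_take (T : eqType) (a : pred T) j (w : seq T) : all a w -> all a (take j w).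
Proof. by move=> /allP H; apply/allP => x /mem_take /H. Qed.

Lemma all_drop (T : eqType) (a : pred T) j (w : seq T) : all a w -> all a (drop j w).
Proof. by move=> /allP H; apply/allP => x /mem_drop /H. Qed.

Lemma mem_ins j m w x : (x \in ins j m w) = (x == m) || (x \in w).
Proof.
by rewrite -[in RHS](cat_take_drop j w) !mem_cat inE orbCA.
Qed.

Lemma size_ins j m w : size (ins j m w) = (size w).+1.
Proof. by rewrite size_cat /= addnS -size_cat cat_take_drop. Qed.

Section Insertion.
Variables (sel : bool) (w : seq nat) (m j : nat).
Hypothesis wm : all (ltn^~ m) w.
Hypothesis jw : j <= size w.
Let p := take j w.
Let q := drop j w.
Let mp : m \notin p. Proof. exact/notin_big/all_take. Qed.
Let mq : m \notin q. Proof. exact/notin_big/all_drop. Qed.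
Let lt_w x : x \in w -> x < m. Proof. by move/(allP wm). Qed.

(** In an occurrence the letters [a], [b], [c] all lie below [d], so a new maximum can only play
    [d]. Occurrences without it lie in [w]; those with it are excluded by [active]. *)
Lemma avoider_ins : avoider sel (ins j m w) <-> avoider sel w /\ active sel w j.
Proof.
split=> [av|[av ac] a b c d ba ca ad].
  split=> [a b c d ba ca ad|a b c ba ca].
    apply/negP => sub; have dw : d \in w.
      by apply: (mem_subseq sub); rewrite /pattern; case: sel; rewrite !inE eqxx !orbT.
    have := av a b c d ba ca ad; rewrite subseq_cat_del ?cat_take_drop ?sub //.
    have := lt_w dw; rewrite /pattern; case: sel; rewrite !inE; lia.
  apply/negP => sub; have aw : a \in w.
    move: sub; case: sel => [/mem_subseq|/andP[/mem_subseq + _]];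
    by move/(_ a (mem_head _ _))/mem_take.
  have am := lt_w aw; have := av a b c m ba ca am.
  have nab : m \notin [:: a; b] by rewrite !inE; lia.
  rewrite /pattern /ins; move: sub; case: sel => /= sub.
    rewrite (subseq_cat_mid [::] (s1 := [:: a; b; c])) // ?sub ?sub0seq //.
    by rewrite !inE; lia.
  by rewrite (subseq_cat_mid [:: c] (s1 := [:: a; b])) // sub1seq sub.
apply/negP => sub.
have dW : d \in ins j m w.
  by apply: (mem_subseq sub); rewrite /pattern; case: sel; rewrite !inE eqxx !orbT.
move: dW; rewrite mem_ins => /orP[/eqP dm|dw]; last first.
  move: sub; rewrite subseq_cat_del ?cat_take_drop; first exact/negP/av.
  by have := lt_w dw; rewrite /pattern; case: sel; rewrite !inE; lia.
have nab : m \notin [:: a; b] by rewrite !inE; lia.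
have := ac a b c ba ca; move: sub; rewrite /pattern /ins dm; case: sel.
  rewrite (subseq_cat_mid [::] (s1 := [:: a; b; c])) //; last by rewrite !inE; lia.
  by case/andP=> ->.
by rewrite (subseq_cat_mid [:: c] (s1 := [:: a; b])) // sub1seq => ->.
Qed.

Lemma take_ins_le k : k <= j -> take k (ins j m w) = take k w.
Proof.
move=> kj; rewrite take_cat size_takel //; case: ltngtP kj => // [kj|->] _.
  by rewrite take_takel // ltnW.
by rewrite subnn take0 cats0.
Qed.

Lemma drop_ins_le k : k <= j -> drop k (ins j m w) = ins (j - k) m (drop k w).
Proof.
move=> kj; rewrite /ins drop_cat size_takel // drop_drop subnK //.
case: ltngtP kj => // [kj|->] _; last by rewrite subnn drop0 take0.
by rewrite take_drop subnK // ltnW.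
Qed.

Lemma take_ins_gt k : j < k -> take k (ins j m w) = p ++ m :: take (k - j.+1) q.
Proof.
move=> jk; rewrite take_cat size_takel // ltnNge (ltnW jk) /=.
by rewrite -[k - j]prednK ?subn_gt0 //= subnS.
Qed.

Lemma drop_ins_gt k : j < k -> drop k (ins j m w) = drop k.-1 w.
Proof.
move=> jk; rewrite drop_cat size_takel // ltnNge (ltnW jk) /=.
rewrite -[k - j]prednK ?subn_gt0 //= drop_drop; congr drop; lia.
Qed.

(** The prefix before such a site is unchanged, and the suffix gains only [m], too large to play
    [c]. *)
Lemma active_ins_le k : k <= j -> active sel (ins j m w) k <-> active sel w k.
Proof.
move=> kj; rewrite /active take_ins_le // drop_ins_le //.
split=> ac a b c ba ca; have := ac a b c ba ca; case: sel => //.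
  by rewrite mem_ins; apply: contra => /andP[-> ->]; rewrite orbT.
rewrite mem_ins; apply: contra => /andP[sub /orP[/eqP cm|->]]; last by rewrite sub.
have /mem_take/lt_w : a \in take k w by apply: (mem_subseq sub); rewrite mem_head.
lia.
Qed.

(** The first letter dominates the others, so the occurrence either starts at [m] or does not use
    it. *)
Lemma subseq_below_top a s r : all (ltn^~ a) s -> all (ltn^~ m) r ->
  subseq (a :: s) (p ++ m :: r) -> (a = m /\ subseq s r) \/ subseq (a :: s) (p ++ r).
Proof.
move=> sa rm sub; have [am|am] := eqVneq a m.
  move: sub; rewrite am (subseq_cat_mid s (s1 := [::])) // ?notin_big // => /andP[_ ?].
  by left.
right; rewrite -(subseq_cat_del (m := m)) // inE eq_sym (negPf am) /=.
have : a \in p ++ m :: r by apply: (mem_subseq sub); rewrite mem_head.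
rewrite mem_cat inE (negPf am) /= => aw; have lt_am : a < m.
  by case/orP: aw => [/mem_take/lt_w|/(allP rm)].
by apply/negP => /(allP sa) /=; lia.
Qed.

(** The prefix gains only [m], at its end: it could only play [a], but no letter follows it
    there. *)
Lemma active_ins_next : active sel w j -> active sel (ins j m w) j.+1.
Proof.
move=> ac a b c ba ca; have := ac a b c ba ca.
have ba1 : all (ltn^~ a) [:: b] by rewrite /= ba.
have ba2 : all (ltn^~ a) [:: b; c] by rewrite /= ba ca.
rewrite take_ins_gt // drop_ins_gt //= subnn take0.
case: sel; apply: contra; last case/andP => + ->.
  by case/(subseq_below_top ba2) => // [[]|]; rewrite ?cats0.
by case/(subseq_below_top ba1) => // [[]|]; rewrite ?cats0 // => ->.
Qed.

Definition far := if sel then j.+2 else (size w).+1.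

(** With [m] as [a], a site is lost once two letters separate it from [m] ([sel = true]), or one
    letter separates and another follows ([sel = false]); only [far] is left. For [sel = true], it
    is active iff [j.+1] was, and activity passes to smaller sites. For [sel = false], the end of a
    word is always active, as nothing remains to play [c]. *)
Lemma active_ins_far k : j.+1 < k <= (size w).+1 ->
  active sel (ins j m w) k <->
  k = far /\ exists2 l, j < l <= size w & active sel w l.
Proof.
case/andP=> jk kw; rewrite /active /far take_ins_gt ?drop_ins_gt //; try lia.
have nthq i : i < size w - j -> nth 0 q i < m.
  by move=> ?; apply/lt_w/(@mem_drop j)/mem_nth; rewrite size_drop.
case: sel; split.
- move=> ac.
  have kE : k = j.+2.
    have [//|jk2] : k = j.+2 \/ j.+2 < k by lia.
    (* The forbidden triple is [m] with the first two letters after it. *)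
    have /negP[] := ac m (nth 0 q 0) (nth 0 q 1) (nthq 0 ltac:(lia)) (nthq 1 ltac:(lia)).
    apply: (@cat_subseq _ [::]) => //=; rewrite ?sub0seq // eqxx.
    have : 1 < size (take (k - j.+1) q) by rewrite size_takel ?size_drop; lia.
    rewrite -[X in _ -> subseq [:: nth _ X _; _] _](cat_take_drop (k - j.+1)).
    rewrite -[X in _ -> subseq [:: _; nth _ X _] _](cat_take_drop (k - j.+1)).
    by case: (take _ q) => [|x [|y r]] //= _; rewrite !eqxx sub0seq.
  split=> //; exists j.+1; first lia.
  move=> a b c ba ca; have := ac a b c ba ca; apply: contra => sub.
  apply: subseq_trans sub (subseq_trans _ (cat_subseq (subseq_refl p) (subseq_cons _ _))).
  by rewrite kE subSS subSnn -takeD addn1 subseq_refl.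
- case=> kE [l /andP[jl lw] ac] a b c ba ca; have := ac a b c ba ca; apply: contra.
  have ba2 : all (ltn^~ a) [:: b; c] by rewrite /= ba ca.
  rewrite kE subSS subSnn.
  case/(subseq_below_top ba2); first exact/all_take/all_drop.
    by case=> _ /size_subseq /=; rewrite size_take_min; lia.
  rewrite -takeD addn1 => /subseq_trans; apply.
  by rewrite -(take_takel _ jl) take_subseq.
- move=> ac; have -> : k = (size w).+1.
    have [//|kw2] : k = (size w).+1 \/ k <= size w by lia.
    have k1 : k.-1 < size w by lia.
    (* Because of the inserted letter, the letter just right of site [k] has index [k.-1] in [w]. *)
    have /negP[] := ac m (nth 0 q 0) (nth 0 w k.-1) (nthq 0 ltac:(lia)) (lt_w (mem_nth 0 k1)).
    rewrite (drop_nth 0) // mem_head andbT.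
    apply: (@cat_subseq _ [::]) => //=; rewrite ?sub0seq // eqxx.
    have -> : k - j.+1 = (k - j.+2).+1 by lia.
    by rewrite /q (drop_nth 0) ?(leq_trans _ k1) //= ?eqxx ?sub0seq //; lia.
  split=> //; exists (size w); first lia.
  by move=> a b c _ _; rewrite drop_size andbF.
by case=> -> _ a b c _ _; rewrite drop_size andbF.
Qed.
End Insertion.

(** * Coding of both classes by ranks of active sites *)

Lemma ltn_nth_sorted s a b :
  sorted ltn s -> a < size s -> b < size s -> (nth 0 s a < nth 0 s b) = (a < b).
Proof.
move=> ss; have mono x y : y < size s -> x < y -> nth 0 s x < nth 0 s y.
  by move=> ys xy; apply: (sorted_ltn_nth ltn_trans 0 ss); rewrite ?inE // (ltn_trans xy).
move=> sa sb; case: (ltngtP a b) => [ab|ba|->]; [by rewrite mono| |by rewrite ltnn].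
by apply/negbTE; rewrite -leqNgt ltnW // mono.
Qed.

Lemma mem_take_sorted s i k : sorted ltn s -> i < size s ->
  (k \in take i.+1 s) = (k \in s) && (k <= nth 0 s i).
Proof.
move=> ss si; apply/idP/andP => [ki|[/(nthP 0)[a sa <-]]].
  split; first exact: mem_take ki.
  case/(nthP 0): ki => a; rewrite size_takel // => ai <-.
  by rewrite nth_take // leqNgt ltn_nth_sorted //; lia.
rewrite leqNgt ltn_nth_sorted // -leqNgt => ai.
by rewrite -(nth_take (n0 := i.+1)) // mem_nth // size_takel.
Qed.

(** Translates the test [i.+1 < size s] of [build] into the existence of a larger active site, as in
    [active_ins_far]. *)
Lemma ltn_size_sorted s i : sorted ltn s -> i < size s ->
  i.+1 < size s <-> exists2 l, l \in s & nth 0 s i < l.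
Proof.
move=> ss si; split=> [i1|[_ /(nthP 0)[a sa <-]]].
  by exists (nth 0 s i.+1); rewrite ?mem_nth // ltn_nth_sorted.
by rewrite ltn_nth_sorted // => /leq_ltn_trans; apply.
Qed.

(* A code lists, last insertion first, the ranks among the active sites at
   which the successive maxima are inserted. *)
Fixpoint build (sel : bool) (c : seq nat) : seq nat * seq nat :=
  if c is i :: c' then
    let: (w, s) := build sel c' in let j := nth 0 s i in
    (ins j (size w).+1 w,
     take i.+1 s ++ j.+1 :: (if i.+1 < size s then [:: far sel w j] else [::]))
  else ([::], [:: 0]).

(** This is the number of active sites of the word built from [c]. It is independent of [sel], which
    is why both classes have the same valid codes. *)
Fixpoint width (c : seq nat) :=
  if c is i :: c' then i.+2 + (i.+1 < width c') else 1.

Fixpoint valid (c : seq nat) :=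
  if c is i :: c' then (i < width c') && valid c' else true.

Lemma perm_iota_ltS w n : perm_eq w (iota 1 n) -> all (ltn^~ n.+1) w.
Proof. by move=> wn; apply/allP => x; rewrite (perm_mem wn) mem_iota /=; lia. Qed.

Lemma perm_ins j n w :
  perm_eq (ins j n.+1 w) (iota 1 n.+1) = perm_eq w (iota 1 n).
Proof.
have -> : iota 1 n.+1 = rcons (iota 1 n) n.+1 by rewrite -cats1 -(addn1 n) iotaD /= addnC.
rewrite perm_sym perm_rcons perm_sym.
by rewrite /ins perm_catC /= perm_cons perm_catC cat_take_drop.
Qed.

(** The invariant of the coding: the list kept by [build] enumerates all active sites in increasing
    order. *)
Lemma build_spec sel c w s : valid c -> build sel c = (w, s) ->
  [/\ perm_eq w (iota 1 (size c)), avoider sel w, size s = width c, sorted ltn s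
    & forall k, k \in s <-> k <= size w /\ active sel w k].
Proof.
elim: c w s => [|i c IHc] W S /=.
  move=> _ [<- <-]; split=> //; first by case: sel.
  move=> k; rewrite inE; split=> [/eqP->|[]]; last by rewrite leqn0.
  by split=> // a b c _ _; case: sel; rewrite ?sub0seq.
case E: (build sel c) => [w s] /andP[ic vc] [<- <-].
have [wc av ss srt memS] := IHc _ _ vc E.
have sw : size w = size c by rewrite (perm_size wc) size_iota.
rewrite -ss in ic; set j := nth 0 s i; set m := (size w).+1.
have wm : all (ltn^~ m) w by rewrite /m sw perm_iota_ltS.
have [jw aj] : j <= size w /\ active sel w j by apply/memS/mem_nth.
have large := ltn_size_sorted srt ic.
have jfar : i.+1 < size s -> j.+1 < far sel w j <= m.
  case/large => l /memS[lw _]; rewrite -/j /far /m; case: (sel); lia.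
split.
- by rewrite /m sw perm_ins.
- exact/avoider_ins.
- by rewrite size_cat size_takel //= -ss; case: (i.+1 < _) => /=; lia.
- rewrite sorted_pairwise; last exact: ltn_trans.
  rewrite pairwise_cat -!sorted_pairwise; try exact: ltn_trans.
  rewrite take_sorted //=; apply/andP; split.
    apply/allrelP => x y; rewrite mem_take_sorted // => /andP[_ xj].
    rewrite inE => /orP[/eqP->|]; first exact: leq_ltn_trans xj _.
    by case: ifP => // /jfar fj; rewrite inE => /eqP->; rewrite -/j in xj; lia.
  by case: ifP => //= /jfar; case/andP=> ->.
move=> k; rewrite mem_cat mem_take_sorted // size_ins -/j.
(* Sites up to [j] are inherited, [j.+1] is always active, and beyond it only [far] can be. *)
have [kj|jk] := leqP k j.
  rewrite active_ins_le // andbT inE.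
  have -> : (k == j.+1) || (k \in if i.+1 < size s then [:: far sel w j] else [::]) = false.
    by case: ifP => [/jfar|_]; rewrite ?inE ?in_nil; lia.
  by rewrite orbF memS; split=> [] [? ?]; split=> //; lia.
rewrite andbF inE /=; have [->|kj] := eqVneq k j.+1.
  by split=> // _; split; [lia | exact: active_ins_next].
have [km|km] := leqP k m; last first.
  case: ifP => [/jfar|_]; rewrite ?inE; split=> [|[]] //; rewrite -/m; lia.
rewrite active_ins_far //; last by rewrite -/m; lia.
split.
  case: ifP => // /large [l /memS[lw al] jl]; rewrite inE => /eqP->; split.
    by case/andP: (jfar (proj2 large (ex_intro2 _ _ l (proj2 (memS l) (conj lw al)) jl))).
  by split=> //; exists l; rewrite // jl.
case=> _ [-> [l /andP[jl lw] al]]; rewrite (_ : i.+1 < size s) ?mem_head //.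
by apply/large; exists l => //; apply/memS.
Qed.

Lemma index_ins_max j m w : m \notin w -> j <= size w -> index m (ins j m w) = j.
Proof.
move=> mw jw; rewrite index_cat ifN ?(contra (@mem_take _ _ _ _)) //=.
by rewrite eqxx addn0 size_takel.
Qed.

Lemma ins_inj j j' m w w' :
  m \notin w -> m \notin w' -> j <= size w -> j' <= size w' ->
  ins j m w = ins j' m w' -> j = j' /\ w = w'.
Proof.
move=> mw mw' jw jw' E.
have jj : j = j' by rewrite -(index_ins_max mw jw) E index_ins_max.
split=> //; subst j'; have /eqP := E.
rewrite /ins eqseq_cat ?size_takel // => /andP[/eqP Et /eqP[Ed]].
by rewrite -(cat_take_drop j w) Et Ed cat_take_drop.
Qed.

Lemma ins_rem m w : m \in w -> exists2 j, j < size w & w = ins j m (rem m w).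
Proof.
move=> mw; exists (index m w); rewrite ?index_mem //.
rewrite remE /ins.
have st : size (take (index m w) w) = index m w by rewrite size_takel // index_size.
rewrite -[X in take X (_ ++ _)]st take_size_cat //.
rewrite -[X in drop X (_ ++ _)]st drop_size_cat //.
by rewrite -[in LHS](cat_take_drop (index m w) w) (drop_nth 0) ?index_mem // nth_index.
Qed.

(** Deleting the maximum recovers the previous word, hence its code by induction and its list of
    sites. That list has no repetition, so the place of the maximum determines the last rank. *)
Lemma build_inj sel c c' : valid c -> valid c' -> size c = size c' ->
  (build sel c).1 = (build sel c').1 -> c = c'.
Proof.
elim: c c' => [|i c IHc] [|i' c'] //= /andP[ic vc] /andP[ic' vc'] [sc].
case E: (build sel c) => [w s]; case E': (build sel c') => [w' s'] /= eW.
have [wc _ ss srt memS] := build_spec vc E.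
have [wc' _ ss' _ memS'] := build_spec vc' E'.
have sw : size w = size c by rewrite (perm_size wc) size_iota.
have sw' : size w' = size c by rewrite (perm_size wc') size_iota.
have [||||jj ww] := ins_inj _ _ _ _ (etrans eW (congr1 (fun k => ins _ k.+1 _) (etrans sw' (esym sw)))).
- by rewrite sw notin_big ?perm_iota_ltS.
- by rewrite sw notin_big ?perm_iota_ltS // sc.
- by apply/(proj1 (proj1 (memS _) _))/mem_nth; rewrite ss.
- by apply/(proj1 (proj1 (memS' _) _))/mem_nth; rewrite ss'.
have cc : c = c' by apply: IHc => //; rewrite E E'.
have [_ ss2] : (w', s') = (w, s) by rewrite -E -E' cc.
rewrite ss2 in jj; move/eqP: jj; rewrite -cc ?nth_uniq ?(sorted_uniq ltn_trans ltnn) //.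
- by move/eqP->.
- by rewrite ss.
by rewrite -ss2 ss'.
Qed.

(** By [avoider_ins], deleting the maximum of an avoider leaves an avoider in which its site was
    active; the rank of this site extends the code. *)
Lemma build_surj sel n w : perm_eq w (iota 1 n) -> avoider sel w ->
  exists2 c, valid c && (size c == n) & (build sel c).1 = w.
Proof.
elim: n w => [|n IHn] W WP avW.
  by exists [::] => //=; rewrite (perm_small_eq _ WP).
have mW : n.+1 \in W by rewrite (perm_mem WP) mem_iota; lia.
have [j jW WE] := ins_rem mW; set w := rem _ _ in WE.
move: WP avW jW; rewrite WE perm_ins size_ins ltnS => wP avW jw.
have [av aj] := (avoider_ins sel (perm_iota_ltS wP) jw).1 avW.
have [c /andP[vc /eqP sc]] := IHn _ wP av.
case E: (build sel c) => [w' s] /= ww; subst w'.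
have [_ _ ss srt memS] := build_spec vc E.
have js : j \in s by apply/memS.
exists (index j s :: c) => /=; first by rewrite -ss index_mem js vc sc /=.
by rewrite E /= nth_index // (perm_size wP) size_iota.
Qed.

(** * Letterwise descriptions of the statistics *)

Section Statistics.
Variable w : seq nat.
Hypotheses (uw : uniq w) (w0 : 0 \notin w).

(** Without repeated letters, a position is recovered from its letter by [index]; the successor
    appears because [letter] counts from 1. *)
Lemma mem_letters (P : pred nat) x :
  (x \in [seq letter w i | i <- iota 1 (size w) & P i]) = (x \in w) && P (index x w).+1.
Proof.
apply/mapP/andP => [[[|i]]|[xw Px]].
- by rewrite mem_filter mem_iota andbF.
- rewrite mem_filter mem_iota add1n /= ltnS => /andP[Pi iw] ->.
  by rewrite mem_nth // index_uniq.
- by exists (index x w).+1; rewrite /= ?nth_index // mem_filter Px mem_iota /= add1n ltnS index_mem.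
Qed.

Lemma map_letter_iota i : i <= size w -> [seq letter w k | k <- iota 1 i] = take i w.
Proof.
by move=> iw; rewrite -[1]addn0 iotaDl -map_comp -(map_nth_iota0 0).
Qed.

Lemma mem_Lrmax x :
  (x \in Lrmax w) = (x \in w) && all (ltn^~ x) (take (index x w) w).
Proof.
rewrite mem_letters; case xw: (x \in w) => //=.
rewrite -map_letter_iota ?index_size // all_map nth_index //.
have -> : 0 < x by case: x xw w0 => // ->.
by [].
Qed.

Lemma mem_Lrmin x :
  (x \in Lrmin w) = (x \in w) && all (ltn x) (take (index x w) w).
Proof.
rewrite mem_letters; case xw: (x \in w) => //=.
rewrite -map_letter_iota ?index_size // all_map nth_index //.
by apply: eq_in_all => -[|k] //; rewrite mem_iota.
Qed.

Lemma mem_Iar x :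
  (x \in Iar w) = (x \in w) && sorted ltn (take (index x w).+1 w).
Proof.
rewrite mem_letters; case xw: (x \in w) => //=.
have iw : (index x w).+1 <= size w by rewrite index_mem.
apply/allP/(sortedP 0); rewrite size_takel // => srt k.
  by move=> kx; rewrite !nth_take // ?(ltnW kx) //; apply: (srt k.+1); rewrite mem_iota; lia.
rewrite mem_iota; case: k => //= k kx.
by have := srt k; rewrite !nth_take //; [apply|]; lia.
Qed.

(** A left-to-right maximum exceeds its left neighbour, or the conventional 0, so only the right
    neighbour matters. Past the end, the default of [nth] is the conventional final 0. *)
Lemma mem_Br x :
  (x \in Br w) = (x \in Lrmax w) && (nth 0 w (index x w).+1 < x).
Proof.
rewrite mem_filter andbC mem_Lrmax mem_letters /=; case xw: (x \in w) => //=.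
case lrm: (all _ _) => //=; rewrite nth_index //.
have -> // : letter w (index x w) < x.
case E: (index x w) lrm => [|k] /allP lrm; first by case: x xw w0 {E lrm} => // ->.
have kw : k.+1 < size w by rewrite -E index_mem.
apply: lrm; rewrite /= -(nth_take (n0 := k.+1)) // mem_nth // size_takel //; exact: ltnW.
Qed.

End Statistics.

(** * Change of the statistics under insertion of a new maximum *)

Section InsertMax.
Variables (n j : nat) (w : seq nat).
Hypotheses (wn : perm_eq w (iota 1 n)) (jn : j <= n).
Let m := n.+1.
Let W := ins j m w.

Let sw : size w = n. Proof. by rewrite (perm_size wn) size_iota. Qed.
Let jw : j <= size w. Proof. by rewrite sw. Qed.
Let uw : uniq w. Proof. by rewrite (perm_uniq wn) iota_uniq. Qed.
Let w0 : 0 \notin w. Proof. by rewrite (perm_mem wn) mem_iota. Qed.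
Let wm : all (ltn^~ m) w. Proof. exact: perm_iota_ltS. Qed.
Let mw : m \notin w. Proof. exact: notin_big. Qed.
Let Wn : perm_eq W (iota 1 m). Proof. by rewrite perm_ins. Qed.
Let uW : uniq W. Proof. by rewrite (perm_uniq Wn) iota_uniq. Qed.
Let W0 : 0 \notin W. Proof. by rewrite (perm_mem Wn) mem_iota. Qed.
Let iW : index m W = j. Proof. exact: index_ins_max. Qed.

Lemma index_ins x : x != m -> index x W = index x w + (j <= index x w).
Proof.
move=> xm; rewrite /W /ins index_cat -[in RHS](cat_take_drop j w) index_cat.
rewrite /= eq_sym (negPf xm) size_takel //; case: ifP => xt.
  by move: xt; rewrite -index_mem size_takel //; lia.
by rewrite leq_addr addn1 addnS.
Qed.

Lemma Lrmax_ins x :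
  (x \in Lrmax W) = (x == m) || (x \in Lrmax w) && (index x w < j).
Proof.
rewrite !mem_Lrmax // mem_ins; have [->|xm] /= := eqVneq x m.
  by rewrite iW take_ins_le // all_take.
case xw: (x \in w) => //=; rewrite index_ins //; have [jx|xj] := leqP j (index x w).
  rewrite andbF addn1 take_ins_gt // all_cat /=.
  by rewrite ltnNge (ltnW (allP wm x xw)) /= andbF.
by rewrite addn0 andbT take_ins_le // ltnW.
Qed.

Lemma Lrmin_ins x : (x \in Lrmin W) = (x == m) && (j == 0) || (x \in Lrmin w).
Proof.
rewrite !mem_Lrmin // mem_ins; have [->|xm] /= := eqVneq x m.
  rewrite iW take_ins_le // (negPf mw) orbF.
  case: (w) wm jw => [|y s] /=; first by case: (j).
  case: (j) => [|k] //= /andP[ym _] _; rewrite ltnNge ltnW //.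
case xw: (x \in w) => //=; rewrite index_ins //; have [jx|xj] := leqP j (index x w).
  rewrite addn1 take_ins_gt // all_cat /= (allP wm x xw : x < m) subSS -all_cat.
  by rewrite -takeD subnKC.
by rewrite addn0 take_ins_le // ltnW.
Qed.

Lemma sorted_cat_peak r : r != [::] -> all (ltn^~ m) r ->
  sorted ltn (take j w ++ m :: r) = false.
Proof.
case: r => // y r _ /= /andP[ym _]; apply/negbTE/negP.
rewrite sorted_pairwise; last exact: ltn_trans.
by rewrite pairwise_cat /= (ltnNge m) (ltnW ym) !andbF.
Qed.

Lemma sorted_take_next : sorted ltn (take j.+1 W) = sorted ltn (take j w).
Proof.
rewrite take_ins_gt // subnn take0 !(sorted_pairwise ltn_trans) pairwise_cat /= andbT.
rewrite (_ : allrel _ _ _) //; apply/allrelP => x y /mem_take/(allP wm) xm.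
by rewrite inE => /eqP->.
Qed.

Lemma sorted_take_far k : j.+1 < k <= n.+1 -> sorted ltn (take k W) = false.
Proof.
case/andP=> jk kn; rewrite take_ins_gt //; last exact: ltnW.
rewrite sorted_cat_peak //; last exact/all_take/all_drop.
by rewrite -size_eq0 size_takel ?size_drop ?sw; lia.
Qed.

(** If the prefix before the site increases, the initial run becomes this prefix followed by [m];
    otherwise the run stops before the site and is unchanged. All letters of an increasing prefix
    are left-to-right maxima, so the data on [Lrmax] already describe it. *)
Lemma Iar_ins x :
  (x \in Iar W) = if sorted ltn (take j w)
                  then (x == m) || (x \in Lrmax w) && (index x w < j)
                  else x \in Iar w.
Proof.
rewrite !mem_Iar // mem_Lrmax // mem_ins; have [->|xm] /= := eqVneq x m.
  by rewrite iW sorted_take_next (negPf mw); case: ifP.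
case xw: (x \in w) => /=; last by case: ifP.
rewrite index_ins //; have [jx|xj] := leqP j (index x w).
  rewrite addn1 sorted_take_far ?andbF; last by have := xw; rewrite -index_mem sw; lia.
  case: ifP => // /negP nsrt; apply/esym/negP => srt; apply: nsrt.
  by rewrite -(take_takel w (leqW jx)) take_sorted.
rewrite addn0 take_ins_le // andbT; case: ifP => // srt.
have srt1 : sorted ltn (take (index x w).+1 w).
  by rewrite -(take_takel _ xj) take_sorted.
rewrite srt1; move: srt1; rewrite (take_nth 0) ?index_mem // nth_index // -cats1.
rewrite (sorted_pairwise ltn_trans) pairwise_cat => /andP[/allrelP lt_x _].
by apply/esym/allP => y yt; apply: lt_x; rewrite // mem_head.
Qed.

(** Letters right of [m] are no longer left-to-right maxima, and the one just left of it is no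
    longer a peak, whence the strict bound on [(index x w).+1]. *)
Lemma Br_ins x : (x \in Br W) = (x == m) || (x \in Br w) && ((index x w).+1 < j).
Proof.
rewrite !mem_Br // Lrmax_ins; have [->|xm] /= := eqVneq x m.
  rewrite iW /W /ins nth_cat size_takel // [j.+1 < j]ltnNge leqnSn /= subSnn /=.
  case: (ltnP 0 (size (drop j w))) => qs; last by rewrite nth_default.
  exact/(allP wm)/(@mem_drop j)/mem_nth.
case xL: (x \in Lrmax w) => //=.
have xw : x \in w by move: xL; rewrite mem_Lrmax // => /andP[].
have [jx|xj] /= := leqP j (index x w); first by rewrite [_ < j](_ : _ = false) ?andbF //; lia.
rewrite index_ins // (leqNgt j) xj addn0.
have [xj1|jx1] := ltnP (index x w).+1 j.
  by rewrite andbT -[nth 0 W _](nth_take (n0 := j)) // take_ins_le // nth_take.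
rewrite andbF; have -> : (index x w).+1 = j by lia.
rewrite /W /ins nth_cat size_takel // ltnn subnn /=.
by apply/negbTE; rewrite -leqNgt ltnW //; apply: (allP wm).
Qed.

(** Old letters keep their relative order, so only the pair [n], [n.+1] is new. The guard [0 < i]
    handles the empty word. *)
Lemma Ides_ins i :
  (i \in Ides W) = (i \in Ides w) || [&& 0 < i, i == n & j <= index n w].
Proof.
rewrite !mem_filter !mem_iota size_ins /= /pos !ltnS sw.
have [->|iN] := eqVneq i n.
  rewrite iW index_ins; last by rewrite /m; lia.
  by case: (leqP j (index n w)) => ?; lia.
case: (ltnP i n) => [lt_in|ni]; last lia.
by rewrite !index_ins /m; lia.
Qed.
End InsertMax.

(* The data on the site [j] of [w] that determine how the statistics change
   when a new maximum is inserted there. *)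
Definition same_site (n : nat) (w : seq nat) (j : nat) (w' : seq nat) (j' : nat) :=
  [/\ (j == 0) = (j' == 0), (j <= index n w) = (j' <= index n w'),
      sorted ltn (take j w) = sorted ltn (take j' w'),
      forall x, (x \in Lrmax w) && (index x w < j)
              = (x \in Lrmax w') && (index x w' < j')
    & forall x, (x \in Br w) && ((index x w).+1 < j)
              = (x \in Br w') && ((index x w').+1 < j')].

(** * Evolution of the site data under insertion *)

Section SiteInsertion.
Variables (n j : nat) (w : seq nat).
Hypotheses (wn : perm_eq w (iota 1 n)) (jn : j <= n).
Let m := n.+1.
Let W := ins j m w.

Let sw : size w = n. Proof. by rewrite (perm_size wn) size_iota. Qed.
Let jw : j <= size w. Proof. by rewrite sw. Qed.
Let uw : uniq w. Proof. by rewrite (perm_uniq wn) iota_uniq. Qed.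
Let w0 : 0 \notin w. Proof. by rewrite (perm_mem wn) mem_iota. Qed.
Let mw : m \notin w. Proof. exact/notin_big/perm_iota_ltS. Qed.
Let iW : index m W = j. Proof. exact: index_ins_max. Qed.
Let mL : m \in Lrmax w = false. Proof. by rewrite mem_Lrmax // (negPf mw). Qed.
Let mB : m \in Br w = false. Proof. by rewrite mem_Br // mL. Qed.

Lemma Lrmax_site_le k x : k <= j ->
  (x \in Lrmax W) && (index x W < k) = (x \in Lrmax w) && (index x w < k).
Proof.
move=> kj; rewrite Lrmax_ins //; have [->|xm] /= := eqVneq x m.
  by rewrite mL iW ltnNge kj.
by rewrite index_ins //; case: (x \in _) => //=; lia.
Qed.

Lemma Br_site_le k x : k <= j ->
  (x \in Br W) && ((index x W).+1 < k) = (x \in Br w) && ((index x w).+1 < k).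
Proof.
move=> kj; rewrite Br_ins //; have [->|xm] /= := eqVneq x m.
  by rewrite mB iW; lia.
by rewrite index_ins //; case: (x \in _) => //=; lia.
Qed.

Lemma Lrmax_site_gt k x : j < k ->
  (x \in Lrmax W) && (index x W < k) = (x == m) || (x \in Lrmax w) && (index x w < j).
Proof.
move=> kj; rewrite Lrmax_ins //; have [->|xm] /= := eqVneq x m; first by rewrite iW.
by rewrite index_ins //; case: (x \in _) => //=; lia.
Qed.

Lemma Br_site_next x :
  (x \in Br W) && ((index x W).+1 < j.+1) = (x \in Br w) && ((index x w).+1 < j).
Proof.
rewrite Br_ins //; have [->|xm] /= := eqVneq x m; first by rewrite iW mB; lia.
by rewrite index_ins //; case: (x \in _) => //=; lia.
Qed.

Lemma Br_site_far k x : j.+1 < k ->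
  (x \in Br W) && ((index x W).+1 < k) = (x == m) || (x \in Br w) && ((index x w).+1 < j).
Proof.
move=> jk; rewrite Br_ins //; have [->|xm] /= := eqVneq x m; first by rewrite iW.
by rewrite index_ins //; case: (x \in _) => //=; lia.
Qed.
End SiteInsertion.

Section SameSite.
Variables (n j j' : nat) (w w' : seq nat).
Hypotheses (wn : perm_eq w (iota 1 n)) (wn' : perm_eq w' (iota 1 n)).
Hypotheses (jn : j <= n) (jn' : j' <= n).
Hypothesis sim : same_site n w j w' j'.
Let W := ins j n.+1 w.
Let W' := ins j' n.+1 w'.
Let jw : j <= size w. Proof. by rewrite (perm_size wn) size_iota. Qed.
Let jw' : j' <= size w'. Proof. by rewrite (perm_size wn') size_iota. Qed.
Let iW : index n.+1 W = j.
Proof. by rewrite index_ins_max // notin_big ?perm_iota_ltS. Qed.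
Let iW' : index n.+1 W' = j'.
Proof. by rewrite index_ins_max // notin_big ?perm_iota_ltS. Qed.

Lemma stats_eq_ins : stats_eq w w' -> stats_eq W W'.
Proof.
case: sim => s0 sI sS sL sB [eB eD eM em eI].
by split=> x; rewrite ?(Br_ins, Ides_ins, Lrmax_ins, Lrmin_ins, Iar_ins) //
  ?sB ?eD ?sI ?sL ?em ?s0 ?sS ?eI.
Qed.

(** The new maximum sits at [j] and [j'], so the clause on its position holds on both sides; the
    other clauses see only the unchanged prefixes. *)
Lemma same_site_le k k' : k <= j -> k' <= j' ->
  same_site n w k w' k' -> same_site n.+1 W k W' k'.
Proof.
move=> kj kj' [s0 _ sS sL sB]; split=> //.
- by rewrite iW iW' kj kj'.
- by rewrite !take_ins_le.
- by move=> x; rewrite !Lrmax_site_le.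
- by move=> x; rewrite !Br_site_le.
Qed.

Lemma same_site_next : same_site n.+1 W j.+1 W' j'.+1.
Proof.
case: sim => s0 sI sS sL sB; split=> //.
- by rewrite iW iW' !ltnn.
- by rewrite !sorted_take_next.
- by move=> x; rewrite !Lrmax_site_gt // sL.
- by move=> x; rewrite !Br_site_next // sB.
Qed.

(** The key to comparing the classes: [k] and [k'] need not be related. Past [j.+1] the site is
    right of the maximum, its prefix has a descent after [m], and no later letter is a left-to-right
    maximum, so the data depend only on what precedes [m]. *)
Lemma same_site_far k k' : j.+1 < k <= n.+1 -> j'.+1 < k' <= n.+1 ->
  same_site n.+1 W k W' k'.
Proof.
move=> jk jk'; have [/andP[jk1 _] /andP[jk1' _]] := (jk, jk').
case: sim => s0 sI sS sL sB; split.
- by rewrite !gtn_eqF //; lia.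
- by rewrite iW iW'; lia.
- by rewrite !sorted_take_far.
- by move=> x; rewrite !Lrmax_site_gt ?sL //; exact: ltnW.
- by move=> x; rewrite !Br_site_far // sB.
Qed.
End SameSite.

(** For the induction, agreement of the statistics is carried together with agreement of all active
    sites of equal rank. *)
Lemma build_same c w s w' s' : valid c ->
  build true c = (w, s) -> build false c = (w', s') ->
  stats_eq w w' /\
  forall i, i < width c -> same_site (size c) w (nth 0 s i) w' (nth 0 s' i).
Proof.
elim: c w s w' s' => [|i c IHc] W S W' S' /=.
  by move=> _ [<- <-] [<- <-]; split=> // -[].
case E: (build true c) => [w s]; case E': (build false c) => [w' s'].
case/andP=> ic vc [<- <-] [<- <-].
have [st sim] := IHc _ _ _ _ vc E E'.
have [wc _ ss srt memS] := build_spec vc E.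
have [wc' _ ss' srt' memS'] := build_spec vc E'.
have sw : size w = size c by rewrite (perm_size wc) size_iota.
have sw' : size w' = size c by rewrite (perm_size wc') size_iota.
have is_ : i < size s by rewrite ss.
have is_' : i < size s' by rewrite ss'.
have [jw _] := (memS _).1 (mem_nth 0 is_).
have [jw' _] := (memS' _).1 (mem_nth 0 is_').
rewrite sw sw' in jw jw' *; have simi := sim i ic.
split=> [|a]; first exact: stats_eq_ins.
have large := ltn_size_sorted srt is_; have large' := ltn_size_sorted srt' is_'.
rewrite ss in large *; rewrite ss' in large' *.
(* Ranks up to [i] are inherited sites, rank [i.+1] is the site just after the maximum, and rank
   [i.+2], if present, is [far]. *)
rewrite !nth_cat !size_takel ?ss ?ss' // => ac; case: (ltnP a i.+1) => [ai|ia].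
  rewrite !nth_take //; apply: same_site_le => //; last by apply: sim; lia.
  - by rewrite leqNgt ltn_nth_sorted ?ss //; lia.
  - by rewrite leqNgt ltn_nth_sorted ?ss' //; lia.
case: ifP ac => i1 ac; last first.
  have -> : a - i.+1 = 0 by lia.
  exact: same_site_next.
have [->|->] : a - i.+1 = 0 \/ a - i.+1 = 1 by lia.
  exact: same_site_next.
have [l /memS[]] := large.1 i1; rewrite sw => lw _ jl.
have [l' /memS'[]] := large'.1 i1; rewrite sw' => lw' _ jl'.
by apply: same_site_far => //=; rewrite /far ?sw'; lia.
Qed.

(** * Pattern avoidance by subsequences, and permutations as words *)

Lemma contains_subseq w P : contains w P <-> exists2 u, subseq u w & order_iso u P.
Proof.
split=> [[m [sm iso]]|[u /subseqP[m sm ->] iso]]; last by exists m.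
by exists (mask m w); first exact: mask_subseq.
Qed.

Lemma avoids_subseq w P : avoids w P <-> forall u, subseq u w -> ~~ order_iso u P.
Proof.
rewrite /avoids contains_subseq; split=> [no u uw|no [u uw]]; last exact/negP/no.
by apply/negP => iso; apply: no; exists u.
Qed.

Lemma order_iso_seq4 u x y z t : order_iso u [:: x; y; z; t] ->
  exists a b c d, u = [:: a; b; c; d].
Proof.
case: u => [|a [|b [|c [|d [|? ?]]]]] //=; first by exists a, b, c, d.
Qed.

Lemma avoiderP sel w : uniq w ->
  avoider sel w <->
  (if sel then avoids w [:: 3; 1; 2; 4] /\ avoids w [:: 3; 2; 1; 4]
   else avoids w [:: 3; 1; 4; 2] /\ avoids w [:: 3; 2; 4; 1]).
Proof.
move=> uw; split=> [av|].
  case: sel av => av; split; apply/avoids_subseq => u uw'; apply/negP => iso;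
    have [a [b [c [d uE]]]] := order_iso_seq4 iso; subst u;
    move: iso; rewrite /order_iso /= => iso.
  - by have /negP[] := av a b c d ltac:(lia) ltac:(lia) ltac:(lia).
  - by have /negP[] := av a b c d ltac:(lia) ltac:(lia) ltac:(lia).
  - by have /negP[] := av a b d c ltac:(lia) ltac:(lia) ltac:(lia).
  - by have /negP[] := av a b d c ltac:(lia) ltac:(lia) ltac:(lia).
(* Distinct letters make [b] and [c] differ, so one of the two patterns of the class occurs. *)
have neq a b c d : subseq (pattern sel a b c d) w -> b != c.
  move/subseq_uniq/(_ uw); rewrite /pattern; case: sel; rewrite /= !inE; lia.
case: sel neq => neq [/avoids_subseq no1 /avoids_subseq no2] a b c d ba ca ad;
  apply/negP => sub; have := neq _ _ _ _ sub; have := no1 _ sub; have := no2 _ sub;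
  rewrite /order_iso /=; lia.
Qed.

Lemma size_word n (s : 'S_n) : size (word s) = n.
Proof. by rewrite size_map size_enum_ord. Qed.

Lemma perm_word n (s : 'S_n) : perm_eq (word s) (iota 1 n).
Proof.
have us : uniq (word s) by rewrite map_inj_uniq ?enum_uniq // => i j [] /val_inj /perm_inj.
have sub : {subset word s <= iota 1 n} by move=> x /mapP[i _ ->]; rewrite mem_iota; case: (s i) => k /=; lia.
apply: uniq_perm; rewrite ?iota_uniq //.
by have [] := uniq_min_size us sub; rewrite // size_word size_iota.
Qed.

Lemma word_inj n : injective (@word n).
Proof.
move=> s t /eq_in_map st; apply/permP => i.
by apply/val_inj; have [] := st i (mem_enum _ _).
Qed.

Lemma word_surj n w : perm_eq w (iota 1 n) -> exists s : 'S_n, word s = w.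
Proof.
move=> wn; have sw : size w = n by rewrite (perm_size wn) size_iota.
have uw : uniq w by rewrite (perm_uniq wn) iota_uniq.
have nw i : i < n -> 0 < nth 0 w i <= n.
  by rewrite -{1}sw => /(mem_nth 0); rewrite (perm_mem wn) mem_iota add1n ltnS.
have fP (i : 'I_n) : (nth 0 w i).-1 < n by have := nw i (ltn_ord i); lia.
pose f i := Ordinal (fP i).
have f_inj : injective f.
  move=> i k [fik]; apply/val_inj/eqP; rewrite -(nth_uniq 0 _ _ uw) ?sw ?ltn_ord //.
  by move: fik (nw i (ltn_ord i)) (nw k (ltn_ord k)) => /=; lia.
exists (perm f_inj); apply: (@eq_from_nth _ 0); rewrite size_word // => i lt_in.
rewrite (nth_map (Ordinal lt_in)) ?size_enum_ord // permE /= nth_enum_ord //.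
by have := nw i lt_in; lia.
Qed.

Lemma containsP w P :
  reflect (contains w P) [exists m : (size w).-tuple bool, order_iso (mask m w) P].
Proof.
apply: (iffP existsP) => [[m iso]|[m [/eqP sm iso]]]; last by exists (Tuple sm).
by exists m; rewrite size_tuple.
Qed.

(** Allows a case split on membership in the class when the bijection is chosen. *)
Lemma avoids_dec w P : decidable (avoids w P).
Proof. by rewrite /avoids; case: (containsP w P) => H; [right; apply | left]. Qed.

Lemma build_word sel n c : valid c -> size c = n ->
  exists2 s : 'S_n, word s = (build sel c).1 & avoider sel (word s).
Proof.
case E: (build sel c) => [w s] vc sc; have [wc av _ _ _] := build_spec vc E.
by rewrite sc in wc; have [t tw] := word_surj wc; exists t; rewrite tw.
Qed.

Lemma word_build sel n (s : 'S_n) : avoider sel (word s) ->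
  exists2 c, valid c && (size c == n) & (build sel c).1 = word s.
Proof. exact/build_surj/perm_word. Qed.

(** * The bijection between permutations with a common code *)

Definition matched n (s t : 'S_n) :=
  exists2 c, valid c && (size c == n)
    & (build true c).1 = word s /\ (build false c).1 = word t.

Theorem theorem2p1 (n : nat) (hn : 1 <= n) :
  exists phi : 'S_n -> 'S_n,
    (forall s, in_A s -> in_B (phi s)) /\
    (forall s t, in_A s -> in_A t -> phi s = phi t -> s = t) /\
    (forall t, in_B t -> exists2 s, in_A s & phi s = t) /\
    (forall s, in_A s -> stats_eq (word s) (word (phi s))).
Proof.
have uw (s : 'S_n) : uniq (word s) by rewrite (perm_uniq (perm_word s)) iota_uniq.
have inA (s : 'S_n) : in_A s <-> avoider true (word s) := iff_sym (avoiderP true (uw s)).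
have inB (s : 'S_n) : in_B s <-> avoider false (word s) := iff_sym (avoiderP false (uw s)).
(* Outside the class the value is arbitrary, and [s] itself is taken. *)
have ex_match (s : 'S_n) : exists t, in_A s -> matched s t.
  case: (avoids_dec (word s) [:: 3; 1; 2; 4]) => [av1|]; last by exists s; case.
  case: (avoids_dec (word s) [:: 3; 2; 1; 4]) => [av2|]; last by exists s; case.
  have [c vc cs] := word_build ((inA s).1 (conj av1 av2)).
  case/andP: (vc) => vc' /eqP sc; have [t tw _] := build_word false vc' sc.
  by exists t => _; exists c; rewrite // -tw.
have [phi phiP] := fin_all_exists ex_match; exists phi.
(* Uniqueness of codes gives injectivity when used for the target class and surjectivity when used
   for the source class. *)
have match_inj sel (c c' : seq nat) : valid c && (size c == n) -> valid c' && (size c' == n) ->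
    (build sel c).1 = (build sel c').1 -> c = c'.
  move=> /andP[vc /eqP sc] /andP[vc' /eqP sc'].
  by apply: build_inj => //; rewrite sc.
split; [|split; [|split]].
- move=> s /phiP[c /andP[vc /eqP sc] [_ ct]]; apply/inB.
  by have [t tw] := build_word false vc sc; rewrite tw ct.
- move=> s t /phiP[c vc [cs cs']] /phiP[d vd [dt dt']] st; apply: word_inj.
  rewrite -cs -dt (match_inj false c d) //.
  by rewrite cs' dt' st.
- move=> t /inB /word_build[c vc ct]; case/andP: (vc) => vc' /eqP sc.
  have [s sw avs] := build_word true vc' sc; have sA := (inA s).2 avs.
  exists s => //; have [d vd [ds dt]] := phiP _ sA.
  by apply: word_inj; rewrite -dt -ct (match_inj true d c) // ds.
move=> s /phiP[c /andP[vc _] [<- <-]].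
case E: (build true c) => [w r]; case E': (build false c) => [w' r'].
by have [] := build_same vc E E'.
Qed.
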